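(* Let $z=(z_1,\dots,z_n)\in\mathbb{R}^n$ be a decreasing vector with distinct entries, and let $\phi_z$ be the map from $n\times n$ real matrices to $\mathbb{R}^n$ given by $\phi_z(X)=zX$ (with $z$ a row vector). Then $\phi_z(ASM_n)=P_z$, where $P_z=\operatorname{conv}\{(z_{\omega(1)},\dots,z_{\omega(n)}) : \omega\in S_n\}$ is the permutohedron.
   Context: An alternating sign matrix (ASM) is a square matrix with entries in $\{0,1,-1\}$ such that the entries of each row and each column sum to $1$, and the nonzero entries in each row and each column alternate in sign. $ASM_n$ is the convex hull in $\mathbb{R}^{n^2}$ of the $n\times n$ alternating sign matrices. $S_n$ is the symmetric group on $\{1,\dots,n\}$. *)

(* Defs.v *)
From HB Require Import structures.
From mathcomp Require Import all_boot all_order all_algebra perm.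
From mathcomp Require Import boolp classical_sets reals convex.

Set Implicit Arguments.
Unset Strict Implicit.
Unset Printing Implicit Defensive.

Import Order.TTheory GRing.Theory Num.Theory.

Local Open Scope classical_set_scope.
Local Open Scope ring_scope.

Definition convex_hull (R : numDomainType) (M : lmodType R) (A : set M) :
  set M := smallest (@convex_set R M) A.

(* Consecutive terms of the subsequence of nonzero terms have opposite signs. *)
Definition alternating (R : realDomainType) (s : seq R) : bool :=
  sorted (fun x y => x * y < 0) [seq x <- s | x != 0].

(* [enum 'I_n] lists the indices in increasing order, so the sequences below
   are the rows read left to right and the columns read top to bottom. *)
Definition is_asm (R : realDomainType) (n : nat) (A : 'M[R]_n) : Prop :=
  [/\ forall i j, A i j \in [:: 0; 1; -1],
      forall i, \sum_j A i j = 1,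
      forall j, \sum_i A i j = 1,
      forall i, alternating [seq A i j | j <- enum 'I_n] &
      forall j, alternating [seq A i j | i <- enum 'I_n]].

Definition ASM (R : realType) (n : nat) : set 'M[R]_n :=
  convex_hull [set A : 'M[R]_n | is_asm A].
Arguments ASM : clear implicits.

Definition permutohedron (R : realType) (n : nat) (z : 'rV[R]_n) :
  set 'rV[R]_n :=
  convex_hull (range (fun w : 'S_n => \row_(i < n) z 0 (w i))).

Definition phi (R : realType) (n : nat) (z : 'rV[R]_n) (X : 'M[R]_n) :
  'rV[R]_n := z *m X.

(* Main.v *)
Require Import Defs.
From HB Require Import structures.
From mathcomp Require Import all_boot all_order all_algebra perm.
From mathcomp Require Import boolp classical_sets reals convex.
From mathcomp Require Import interval_inference lra ring.

Set Implicit Arguments.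
Unset Strict Implicit.
Unset Printing Implicit Defensive.

Import Order.TTheory GRing.Theory Num.Theory.

Local Open Scope classical_set_scope.
Local Open Scope ring_scope.

(** Column prefix sums of an alternating sign matrix A are 0 or 1, and the prefix
    sums of rows 0..k add up to k+1. By Abel summation, z *m A is therefore the
    constant vector z_last plus the sum of (z_k - z_(k+1)) *: 1_(T k) with
    #|T k| = k+1, while z is the same combination with T k replaced by {0..k}.
    Adding one term at a time keeps the point in the permutohedron of the
    corresponding partial sum of z, by an exchange argument. Conversely,
    permutation matrices are alternating sign matrices. *)

(** * Convex sets and hulls *)

Lemma convex_setP (R : numDomainType) (M : lmodType R) (A : set M) :
  @convex_set R M A <->
  (forall x y t, 0 <= t -> t <= 1 -> A x -> A y -> A (t *: x + (1 - t) *: y)).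
Proof.
split=> [cA x y t t0 t1 Ax Ay|cA x y t /set_mem Ax /set_mem Ay]; last first.
  by apply/mem_set; apply: cA.
by have /set_mem := cA x y (Itv01 t0 t1) (mem_set Ax) (mem_set Ay).
Qed.

Lemma convex_hull_convex (R : numDomainType) (M : lmodType R) (A : set M) :
  @convex_set R M (convex_hull A).
Proof.
apply/convex_setP => x y t t0 t1 Ax Ay B [cB AB].
by move/convex_setP: (cB); apply=> //; [apply: Ax | apply: Ay].
Qed.

(** The preimage of [B] under an affine map is convex and contains [A], hence the hull. Affinity,
    weaker than linearity, admits translations. *)
Lemma convex_hull_map (R : numDomainType) (M N : lmodType R) (f : M -> N)
    (A : set M) (B : set N) :
  (forall t x y, f (t *: x + (1 - t) *: y) = t *: f x + (1 - t) *: f y) ->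
  @convex_set R N B -> (forall x, A x -> B (f x)) ->
  forall x, convex_hull A x -> B (f x).
Proof.
move=> f_aff /convex_setP cB AB x Ax; apply: (Ax (f @^-1` B)); split=> //.
by apply/convex_setP => u v t t0 t1 Bu Bv; rewrite /preimage/= f_aff; apply: cB.
Qed.

(** * Prefix sums of alternating sequences *)

Section AlternatingSequences.
Variable R : realDomainType.
Implicit Types (e : R) (s : seq R).

(** Starting the path at [- e] forces the first nonzero term to be [e]; the terms after it satisfy
    the same condition for [- e], so their prefix sums are [0] or [- e]. *)
Lemma alternating_path_prefix e s k :
  e \in [:: 1; -1] -> all (fun x => x \in [:: 0; 1; -1]) s ->
  path (fun x y => x * y < 0) (- e) [seq x <- s | x != 0] ->
  \sum_(x <- take k s) x \in [:: 0; e].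
Proof.
elim: s e k => [|a s IHs] e [|k] e1 /=; rewrite ?big_nil ?mem_head //.
case/andP=> a01 s01; rewrite big_cons.
have [->|a0] /= := eqVneq a 0; first by rewrite add0r; apply: IHs.
case/andP=> ea0 ps.
have ae : a = e.
  move: a01 e1 ea0 a0; rewrite !inE => /or3P[]/eqP-> /orP[]/eqP->;
    rewrite ?eqxx // ?opprK ?mulN1r ?mul1r ?opprK ?ltr10 //.
subst a.
have Ne1 : - e \in [:: 1; -1] by move: e1; rewrite !inE eqr_oppLR eqr_opp orbC.
have := IHs (- e) k Ne1 s01; rewrite opprK !inE => /(_ ps) /orP[]/eqP->.
  by rewrite addr0 eqxx orbT.
by rewrite subrr eqxx.
Qed.

Lemma alternating_prefix s k :
  all (fun x => x \in [:: 0; 1; -1]) s -> alternating s ->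
  \sum_(x <- s) x = 1 -> \sum_(x <- take k s) x \in [:: 0; 1].
Proof.
move=> s01 alt sum1.
have [e e1 pe] : exists2 e, e \in [:: 1; -1] &
    path (fun x y => x * y < 0) (- e) [seq x <- s | x != 0].
  move: alt; rewrite /alternating.
  (* Take [e] to be the first nonzero term; without one, any sign works. *)
  case Ef : [seq _ <- s | _] => [|a f] /= pf; first by exists 1; rewrite ?mem_head.
  have : a \in [seq x <- s | x != 0] by rewrite Ef mem_head.
  rewrite mem_filter => /andP[a0 /(allP s01)]; rewrite inE (negPf a0) /= => a1.
  by exists a => //; rewrite pf mulNr oppr_lt0 andbT -expr2 exprn_even_gt0.
(* The total sum [1] is itself a prefix sum, so it is [0] or [e]. *)
have eE : 1 = e.
  have := alternating_path_prefix (size s) e1 s01 pe.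
  by rewrite take_size sum1 !inE oner_eq0 /= => /eqP.
by rewrite eE; apply: alternating_path_prefix.
Qed.

Lemma big_take_enum n (f : 'I_n -> R) k :
  \sum_(x <- take k [seq f i | i <- enum 'I_n]) x = \sum_(i < n | (i < k)%N) f i.
Proof.
rewrite -map_take big_map big_uniq ?take_uniq ?enum_uniq //=.
by apply: eq_bigl => i; rewrite in_take ?mem_enum // index_enum_ord.
Qed.

Lemma alternating_delta n (a : 'I_n) :
  alternating [seq ((j == a)%:R : R) | j <- enum 'I_n].
Proof.
rewrite /alternating filter_map (@eq_filter _ _ (pred1 a)) => [|j /=].
  by rewrite filter_pred1_uniq ?enum_uniq ?mem_enum.
by rewrite pnatr_eq0 eqb0 negbK.
Qed.

End AlternatingSequences.

(** * Column prefixes and permutation matrices *)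

Section ASM.
Variable R : realDomainType.

Lemma asm_col_prefix n (A : 'M[R]_n) (j : 'I_n) k : is_asm A ->
  \sum_(i < n | (i < k)%N) A i j \in [:: 0; 1].
Proof.
case=> A01 _ csum _ calt; rewrite -big_take_enum; apply: alternating_prefix => //.
  by apply/allP => _ /mapP[i _ ->].
by rewrite big_map big_enum.
Qed.

(** Column [j] has its [1] in row [w j], so [z] times this matrix is the vertex with entries
    [z 0 (w j)]. *)
Lemma perm_asm n (w : 'S_n) : is_asm (\matrix_(i, j) (i == w j)%:R : 'M[R]_n).
Proof.
have eqV i j : (i == w j) = (j == (w^-1)%g i).
  by rewrite eq_sym (can2_eq (permK w) (permKV w)).
split=> [i j|i|j|i|j].
- by rewrite mxE; case: (_ == _); rewrite !inE eqxx ?orbT.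
- rewrite (bigD1 ((w^-1)%g i)) //= mxE eqV eqxx big1 ?addr0 // => j.
  by rewrite mxE eqV => /negPf->.
- rewrite (bigD1 (w j)) //= mxE eqxx big1 ?addr0 // => i.
  by rewrite mxE => /negPf->.
- rewrite (eq_map (_ : _ =1 fun j => (j == (w^-1)%g i)%:R)) => [|j].
    exact: alternating_delta.
  by rewrite mxE eqV.
- rewrite (eq_map (_ : _ =1 fun i => (i == w j)%:R)) => [|i].
    exact: alternating_delta.
  by rewrite mxE.
Qed.

End ASM.

(** * Adding an indicator vector by exchange *)

Section Permutohedron.
Variables (R : realType) (n : nat).
Implicit Types (w z : 'rV[R]_n) (K T : {set 'I_n}) (s : 'S_n).

Definition indic K : 'rV[R]_n := \row_i (i \in K)%:R.

Lemma permutohedron_perm z s : permutohedron z (\row_i z 0 (s i)).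
Proof. by apply: sub_gen_smallest; exists s. Qed.

Lemma permutohedron_convex z x y t : 0 <= t -> t <= 1 ->
  permutohedron z x -> permutohedron z y ->
  permutohedron z (t *: x + (1 - t) *: y).
Proof.
move=> t0 t1 Px Py; have /convex_setP := @convex_hull_convex R _
  (range (fun s : 'S_n => \row_(i < n) z 0 (s i))); exact.
Qed.

(* If u lies outside T and v inside it, and s gives u the larger entry, then the
   point is a convex combination of the one with u and v exchanged in T and the
   one with u and v exchanged in s; both are closer to T = s @^-1: K. *)
Lemma permutohedron_perm_indic w K T s b : 0 <= b ->
  (forall i j, i \in K -> j \notin K -> w 0 j <= w 0 i) -> #|T| = #|K| ->
  permutohedron (w + b *: indic K) (\row_j w 0 (s j) + b *: indic T).
Proof.
move=> b0 wK; move Em : #|T :\: s @^-1: K| => m.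
(* In the base case equal cardinalities give [T = s @^-1: K], and the point is the vertex of [s]. *)
elim: m => [|m IHm] in T s Em *; move=> cTK;
  have cS (t : 'S_n) : #|t @^-1: K| = #|T| by rewrite card_preimset ?cTK //; apply: perm_inj.
  have ET : T = s @^-1: K.
    apply/eqP; rewrite eqEcard cS leqnn andbT -finset.setD_eq0.
    by apply/eqP/cards0_eq.
  set x := (X in permutohedron _ X).
  have -> : x = \row_j (w + b *: indic K) 0 (s j); last exact: permutohedron_perm.
  by apply/rowP => j; rewrite !mxE ET inE.
have [v vTS] : exists v, v \in T :\: s @^-1: K by apply/card_gt0P; rewrite Em.
have [u uST] : exists u, u \in s @^-1: K :\: T.
  by apply/card_gt0P; rewrite cardsD cS finset.setIC -cardsD Em.
move: (vTS) uST; rewrite !inE => /andP[vK vT] /andP[uT uK].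
have uv : u != v by apply: contraNneq uT => ->.
pose T1 := u |: (T :\ v); pose s1 := (tperm u v * s)%g.
have cm : #|(T :\: s @^-1: K) :\ v| = m.
  by move: (cardsD1 v (T :\: s @^-1: K)); rewrite vTS Em => -[].
have P1 : permutohedron (w + b *: indic K) (\row_j w 0 (s j) + b *: indic T1).
  apply: IHm.
    rewrite -cm; apply: eq_card => j; rewrite !inE.
    have [->|ju] := eqVneq j u; first by rewrite uK andbF.
    by rewrite /= andbCA.
  by rewrite cardsU1 !inE (negPf uT) andbF -cTK (cardsD1 v T) vT.
have P2 : permutohedron (w + b *: indic K) (\row_j w 0 (s1 j) + b *: indic T).
  apply: IHm => //.
  rewrite -cm; apply: eq_card => j; rewrite !inE permM.
  have [->|ju] := eqVneq j u; first by rewrite (negPf uT) !andbF.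
  have [->|jv] := eqVneq j v; first by rewrite tpermR uK.
  by rewrite tpermD // eq_sym.
have wle := wK _ _ uK vK.
pose d := w 0 (s u) - w 0 (s v).
have d0 : 0 <= d by rewrite subr_ge0.
(* Here the weight [d / (d + b)] would degenerate, but [b = 0] removes the indicators and [P1] is
   the claim. *)
have [db0|db0] := eqVneq (d + b) 0.
  have [Ed Eb] : d = 0 /\ b = 0 by split; lra.
  by move: P1; rewrite Eb !scale0r.
have db : 0 < d + b by rewrite lt_def db0 addr_ge0.
(* The weight solves [t * (d + b) = d], the equation at coordinate [u] once [w 0 (s v)] is
   subtracted; coordinate [v] follows, as all three points have the same sum over [u] and [v]. *)
have t0 : 0 <= d / (d + b) by rewrite divr_ge0 // ltW.
have t1 : d / (d + b) <= 1 by rewrite ler_pdivrMr // mul1r lerDl.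
move: (permutohedron_convex t0 t1 P1 P2).
set x := (X in permutohedron _ X); set y := (X in _ -> permutohedron _ X).
suff -> : x = y by [].
apply/rowP => j; rewrite !mxE !inE permM.
have [->|ju] := eqVneq j u.
  by rewrite tpermL (negPf uT) /= /d; move: db0; rewrite /d => ?; field.
have [->|jv] := eqVneq j v.
  by rewrite tpermR vT /= /d; move: db0; rewrite /d => ?; field.
by rewrite tpermD 1?eq_sym //=; ring.
Qed.

(** Translation by [b *: indic T] is affine, so the case of vertices suffices. *)
Lemma permutohedronD_indic w K T x b : 0 <= b ->
  (forall i j, i \in K -> j \notin K -> w 0 j <= w 0 i) -> #|T| = #|K| ->
  permutohedron w x -> permutohedron (w + b *: indic K) (x + b *: indic T).
Proof.
move=> b0 wK cTK; apply: (convex_hull_map (f := fun x => x + b *: indic T)).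
- by move=> t u v; apply/rowP => j; rewrite !mxE; ring.
- exact: convex_hull_convex.
- by move=> _ [s _ <-]; apply: permutohedron_perm_indic.
Qed.

End Permutohedron.

(** * Abel summation and the two inclusions *)

Lemma asm_permutohedron (R : realType) n (z : 'rV[R]_n) (A : 'M[R]_n) :
  (forall i j : 'I_n, (i <= j)%N -> z 0 j <= z 0 i) -> is_asm A ->
  permutohedron z (z *m A).
Proof.
case: n => [|n] in z A *; move=> zdec asmA.
  suff -> : z *m A = \row_i z 0 ((1 : 'S_0)%g i) by apply: permutohedron_perm.
  by apply/rowP => -[].
have [_ rsum csum _ _] := asmA.
pose d k := z 0 (inord k) - z 0 (inord k.+1).
pose K k : {set 'I_n.+1} := [set i : 'I_n.+1 | (i <= k)%N]%SET.
pose T k : {set 'I_n.+1} := [set j | \sum_(i < n.+1 | (i < k.+1)%N) A i j == 1]%SET.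
have TE k j : \sum_(i < n.+1 | (i < k.+1)%N) A i j = (j \in T k)%:R.
  rewrite inE; have := asm_col_prefix j k.+1 asmA.
  by rewrite !inE => /orP[]/eqP->; rewrite ?eqxx // eq_sym oner_eq0.
(* Double counting in [R]: sum the first [k.+1] rows by columns, then by rows. *)
have cT k : #|T k| = #|K k|.
  apply/eqP; rewrite -(eqr_nat R) -!sum1_card !natr_sum !big_mkcond /=.
  rewrite (eq_bigr (fun j => \sum_(i < n.+1 | (i < k.+1)%N) A i j)) => [|j _].
    rewrite exchange_big /=; apply/eqP; apply: eq_big => [i|i _]; last exact: rsum.
    by rewrite inE ltnS.
  by rewrite TE; case: (j \in T k).
(* The Abel sum cut after [m] terms: [W K n] will be [z] and [W T n] will be [z *m A]. *)
pose W (S : nat -> {set 'I_n.+1}) m : 'rV[R]_n.+1 :=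
  const_mx (z 0 (inord n)) + \sum_(k < m) d k *: indic R (S k).
have WS S m : W S m.+1 = W S m + d m *: indic R (S m).
  by rewrite /W big_ord_recr addrA.
have d0 k : (k < n)%N -> 0 <= d k.
  by move=> kn; rewrite subr_ge0 zdec // !inordK // ltnW // ltnS ltnW.
have WE S m j : W S m 0 j = z 0 (inord n) + \sum_(k < m) d k * (j \in S k)%:R.
  by rewrite !mxE summxE; congr (_ + _); apply: eq_bigr => k _; rewrite !mxE.
have Wdec m (i j : 'I_n.+1) : (m <= n)%N -> (i <= j)%N -> W K m 0 j <= W K m 0 i.
  move=> mn ij; rewrite !WE lerD2l; apply: ler_sum => k _.
  rewrite ler_wpM2l ?d0 ?(leq_trans (ltn_ord k)) // ler_nat !inE.
  by case: (leqP j k) => // jk; rewrite (leq_trans ij jk).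
have PW m : (m <= n)%N -> permutohedron (W K m) (W T m).
  elim: m => [_|m IHm mn].
    suff -> : W T 0 = \row_i W K 0 0 ((1 : 'S_n.+1)%g i).
      exact: permutohedron_perm.
    by apply/rowP => i; rewrite [RHS]mxE !WE !big_ord0.
  rewrite !WS; apply: permutohedronD_indic => //; first exact: d0.
    move=> i j; rewrite !inE -ltnNge => ik kj.
    by apply: Wdec; rewrite ltnW // (leq_ltn_trans ik kj).
  by apply: IHm; rewrite ltnW.
(* At coordinate [i] only the terms with [i <= k < n] survive, and they telescope. *)
have zW : z = W K n.
  apply/rowP => i; rewrite WE.
  under eq_bigr do rewrite inE mulr_natr mulrb.
  have iN : (i <= n)%N by rewrite -ltnS.
  rewrite -big_mkcond /= -(big_geq_mkord _ _ xpredT d).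
  rewrite (telescope_sumr_eq (fun k => - z 0 (inord k)) d iN) => [|k _].
    by rewrite inord_val opprK; ring.
  by rewrite opprK addrC.
suff -> : z *m A = W T n by rewrite {1}zW; apply: PW.
(* Column sums [1] preserve the constant part; each indicator of [K k] becomes a column prefix sum,
   which [TE] identifies. *)
apply/rowP => j; rewrite mxE WE {1}zW.
under eq_bigr do rewrite WE mulrDl mulr_suml.
rewrite big_split /= -mulr_sumr csum mulr1; congr (_ + _).
rewrite exchange_big /=; apply: eq_bigr => k _.
rewrite -TE mulr_sumr [RHS]big_mkcond /=; apply: eq_bigr => i _.
by rewrite inE ltnS; case: (i <= k)%N; rewrite ?mulr1 ?mulr0 ?mul0r.
Qed.

Theorem theorem3p8 (R : realType) (n : nat) (z : 'rV[R]_n)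
    (z_decreasing : forall i j : 'I_n, (i <= j)%N -> z 0 j <= z 0 i)
    (z_distinct : injective (fun i : 'I_n => z 0 i)) :
  phi z @` ASM R n = permutohedron z.
Proof.
have phi_aff t X Y :
    phi z (t *: X + (1 - t) *: Y) = t *: phi z X + (1 - t) *: phi z Y.
  by rewrite /phi mulmxDr -!scalemxAr.
apply/seteqP; split=> [_ [X AX <-]|].
  apply: (convex_hull_map phi_aff _ _ AX); first exact: convex_hull_convex.
  by move=> A; apply: asm_permutohedron.
(* The image of the hull is convex, so it is enough that it contains the vertices. *)
apply: smallest_sub.
  apply/convex_setP => _ _ t t0 t1 [X AX <-] [Y AY <-].
  exists (t *: X + (1 - t) *: Y); last exact: phi_aff.
  by have /convex_setP := @convex_hull_convex R _ [set A : 'M[R]_n | is_asm A]; apply.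
move=> _ [w _ <-]; exists (\matrix_(i, j) (i == w j)%:R).
  by apply: sub_gen_smallest; apply: perm_asm.
apply/rowP => j; rewrite !mxE (bigD1 (w j)) //= mxE eqxx mulr1 big1 ?addr0 // => i.
by rewrite mxE => /negPf->; rewrite mulr0.
Qed.
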